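(* Let $F(x,y)=\left(x+\frac{2y^2(-x^2+x+y^2)}{(x-1-y)(x^2-1+y-y^2)},\ \frac{y^2(x-1+y)}{(x-1-y)(x^2-1+y-y^2)}\right)$ and let $\varpi\colon\mathbb{C}^2\dashrightarrow\mathbb{C}^2$ be the birational map $$\varpi(x,y)=\left(\frac{x^2-1-xy-2y^2}{y},\ \frac{(1+x-2y)(1+x+y)}{2y}\right).$$ Then $\varpi\circ F\circ\varpi^{-1}(u,v)=\left(u^2-u-3,\ \frac{(u-1)(u+2)}{u+3}\,v\right)$. In particular $\psi(x,y)=\frac{x^2-1-xy-2y^2}{y}$ satisfies $\psi\circ F=g\circ\psi$ with $g(u)=u^2-u-3$, and $F$ has topological degree $2$ and first dynamical degree $2$.
   Context: The first dynamical degree is $\lambda_1(F)=\lim_n\deg(F^n)^{1/n}$ with $\deg$ the algebraic degree of the homogeneous extension to $\mathbb{P}^2$; the topological degree is the number of preimages of a generic point. *)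

(* Defs.v *)
From HB Require Import structures.
From mathcomp Require Import all_boot all_order all_algebra.
From mathcomp Require Import all_classical all_reals all_analysis.
From mathcomp.real_closed Require Import complex.
Import numFieldNormedType.Exports.
Set Implicit Arguments. Unset Strict Implicit. Unset Printing Implicit Defensive.
Import Order.TTheory GRing.Theory Num.Theory.
Local Open Scope ring_scope.
Local Open Scope classical_set_scope.

(* Bivariate polynomials over K: p : {poly {poly K}}, the INNER variable is x,
   the OUTER variable is y.  Rational functions in (x,y): the fraction field. *)
Definition RF (K : fieldType) := {fraction {poly {poly K}}}.

Definition ratmap (K : fieldType) := (RF K * RF K)%type.

Definition xF (K : fieldType) : RF K := tofrac (('X : {poly K})%:P).
Definition yF (K : fieldType) : RF K := tofrac ('X : {poly {poly K}}).

Definition ev2 (K : fieldType) (p : {poly {poly K}}) (a b : K) : K :=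
  (p.[b%:P]).[a].

Definition cstF (K : fieldType) (c : K) : RF K := tofrac (c%:P%:P).

Definition psubst (K : fieldType) (p : {poly {poly K}}) (g : ratmap K) : RF K :=
  (map_poly (fun q : {poly K} => (map_poly (@cstF K) q).[g.1]) p).[g.2].

(* substitution in a rational function, through its (chosen) representative
   numerator/denominator; this is the usual composition for dominant g *)
Definition rsubst (K : fieldType) (f : RF K) (g : ratmap K) : RF K :=
  psubst (frac (repr f)).1 g / psubst (frac (repr f)).2 g.

Definition rcomp (K : fieldType) (f g : ratmap K) : ratmap K :=
  (rsubst f.1 g, rsubst f.2 g).

Definition ridm (K : fieldType) : ratmap K := (xF K, yF K).

Definition riter (K : fieldType) (F : ratmap K) (n : nat) : ratmap K :=
  iter n (fun G => rcomp F G) (ridm K).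

(* total degree of a bivariate polynomial (0 for the zero polynomial) *)
Definition tdeg (K : fieldType) (p : {poly {poly K}}) : nat :=
  \max_(i < size p)
    (if (nth 0 p i == 0)%R then 0%N else ((size (nth 0%R p i)).-1 + i)%N).

Definition deg_rep (K : fieldType) (H : ratmap K) (d : nat) : Prop :=
  exists A B C : {poly {poly K}}, [/\ C != 0,
    H.1 = tofrac A / tofrac C, H.2 = tofrac B / tofrac C &
    maxn (tdeg A) (maxn (tdeg B) (tdeg C)) = d].

(* algebraic degree of the homogeneous extension [A^h : B^h : C^h] to P^2:
   the degree of the reduced (coprime) triple, i.e. the least possible d. *)
Definition algdeg (K : fieldType) (H : ratmap K) : nat :=
  xget 0%N [set d | deg_rep H d /\ forall d', deg_rep H d' -> (d <= d')%N].

Definition rval (K : fieldType) (f : RF K) (z : K * K) (v : K) : Prop :=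
  exists n d : {poly {poly K}}, [/\ ev2 d z.1 z.2 != 0,
    f = tofrac n / tofrac d & v = ev2 n z.1 z.2 / ev2 d z.1 z.2].

Definition maps_to (K : fieldType) (F : ratmap K) (z w : K * K) : Prop :=
  rval F.1 z w.1 /\ rval F.2 z w.2.

Definition topdeg_is (K : fieldType) (F : ratmap K) (k : nat) : Prop :=
  exists P : {poly {poly K}}, P != 0 /\
    forall w : K * K, ev2 P w.1 w.2 != 0 ->
      exists s : seq (K * K), [/\ uniq s, size s = k &
        forall z, z \in s <-> maps_to F z w].

Definition dyn_deg_is (R : realType) (F : ratmap R[i]) (l : R) : Prop :=
  (fun n : nat => ((algdeg (riter F n))%:R : R) `^ (n%:R^-1)) @ \oo --> l.

(* Main.v *)
(**
Write [u = psi] and [v] for the components of [varpi], so that [varpi] conjugates [F] to the skew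
product [G (u, v) = (g u, r u * v)].  The identity
[(2 v - u)^2 - 9 = 8 v / y] shows that [varpi] is birational, with inverse
[y = 8 v / ((2 v - u)^2 - 9)] and [x = (2 v - u + 1) / 2 * y - 1].

Topological degree: a generic [(a, b)] with [varpi (a, b) = (U, V)] has exactly one preimage over
each of the two roots [u] of [g u = U], namely the point with [v = V / r u].  The only points where
the second component of [F] could be regular although its denominator vanishes are the common
zeros [(1, 0)] and [(-1, 0)] of its numerator and denominator; each contributes at most one value,
which is excluded.

Dynamical degree: [u] composed with the [n]-th iterate of [F] is [g^n (psi)], which has a pole of
order [2^n] along [y = 0], hence [2^n <= 2 * deg (F^n)].  Conversely, [F^n = varpi^-1 (G^n varpi)]
and the components of [G^n varpi] are quotients of polynomials of degree at most [4 * 2^n], hence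
[deg (F^n) <= 12 * 2^n].
*)
Require Import Defs.
From HB Require Import structures.
From mathcomp Require Import all_boot all_order all_algebra.
From mathcomp Require Import all_classical all_reals all_analysis.
From mathcomp.real_closed Require Import complex.
From mathcomp Require Import ring zify.
Import Order.TTheory GRing.Theory Num.Theory.
Set Implicit Arguments. Unset Strict Implicit. Unset Printing Implicit Defensive.
Local Open Scope ring_scope.

(** * Substitution and evaluation of rational functions *)

Lemma cstF_zmod (K : fieldType) : zmod_morphism (@cstF K).
Proof. by move=> a b; rewrite /cstF !rmorphB. Qed.

Lemma cstF_monoid (K : fieldType) : monoid_morphism (@cstF K).
Proof. by split=> [|a b]; rewrite /cstF ?rmorph1 // !rmorphM. Qed.

HB.instance Definition _ (K : fieldType) :=
  GRing.isZmodMorphism.Build K (RF K) (@cstF K) (@cstF_zmod K).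
HB.instance Definition _ (K : fieldType) :=
  GRing.isMonoidMorphism.Build K (RF K) (@cstF K) (@cstF_monoid K).

(** Convertible to [psubst _ g]; packaging it as a ring morphism gives the compatibility lemmas
    through [rmorphD], [rmorphM] and the like. *)
Definition psubst_hom (K : fieldType) (g : ratmap K) :
    {rmorphism {poly {poly K}} -> RF K} :=
  horner_eval g.2 \o map_poly (horner_eval g.1 \o map_poly (@cstF K)).

Lemma psubstE (K : fieldType) (p : {poly {poly K}}) (g : ratmap K) :
  psubst p g = psubst_hom g p.
Proof. by []. Qed.

Definition ev2_hom (K : fieldType) (z : K * K) :
    {rmorphism {poly {poly K}} -> K} :=
  horner_eval z.1 \o horner_eval z.2%:P.

Lemma ev2E (K : fieldType) (p : {poly {poly K}}) (a b : K) :
  ev2 p a b = ev2_hom (a, b) p.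
Proof. by []. Qed.

Lemma psubst1 (K : fieldType) (g : ratmap K) : psubst 1 g = 1.
Proof. by rewrite psubstE rmorph1. Qed.

Lemma psubstD (K : fieldType) (g : ratmap K) p q :
  psubst (p + q) g = psubst p g + psubst q g.
Proof. by rewrite !psubstE rmorphD. Qed.

Lemma psubstM (K : fieldType) (g : ratmap K) p q :
  psubst (p * q) g = psubst p g * psubst q g.
Proof. by rewrite !psubstE rmorphM. Qed.

Lemma ev2D (K : fieldType) p q (a b : K) : ev2 (p + q) a b = ev2 p a b + ev2 q a b.
Proof. by rewrite !ev2E rmorphD. Qed.

Lemma ev2M (K : fieldType) p q (a b : K) : ev2 (p * q) a b = ev2 p a b * ev2 q a b.
Proof. by rewrite !ev2E rmorphM. Qed.

Lemma ev2N (K : fieldType) p (a b : K) : ev2 (- p) a b = - ev2 p a b.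
Proof. by rewrite !ev2E rmorphN. Qed.

Lemma ev2_nat (K : fieldType) n (a b : K) : ev2 n%:R a b = n%:R.
Proof. by rewrite ev2E rmorph_nat. Qed.

Lemma ev2_1 (K : fieldType) (a b : K) : ev2 1 a b = 1.
Proof. by rewrite ev2E rmorph1. Qed.

Lemma ev2Xn (K : fieldType) p n (a b : K) : ev2 (p ^+ n) a b = ev2 p a b ^+ n.
Proof. by rewrite !ev2E rmorphXn. Qed.

Lemma psubstX (K : fieldType) (g : ratmap K) : psubst 'X%:P g = g.1.
Proof. by rewrite psubstE /= map_polyC /= /horner_eval hornerC map_polyX hornerX. Qed.

Lemma psubstY (K : fieldType) (g : ratmap K) : psubst 'X g = g.2.
Proof. by rewrite psubstE /= map_polyX /horner_eval hornerX. Qed.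

Lemma psubstC (K : fieldType) (g : ratmap K) c : psubst c%:P%:P g = cstF c.
Proof. by rewrite psubstE /= !map_polyC /= /horner_eval !hornerC map_polyC hornerC. Qed.

Lemma ev2X (K : fieldType) (a b : K) : ev2 'X%:P a b = a.
Proof. by rewrite /ev2 hornerC hornerX. Qed.

Lemma ev2Y (K : fieldType) (a b : K) : ev2 'X a b = b.
Proof. by rewrite /ev2 hornerX hornerC. Qed.

Lemma ev2C (K : fieldType) (a b c : K) : ev2 c%:P%:P a b = c.
Proof. by rewrite /ev2 !hornerC. Qed.

Definition ev2_simpl := (ev2_1, ev2D, ev2M, ev2N, ev2_nat, ev2Xn, ev2C, ev2X, ev2Y).

(** Constants, [x] and [y] generate the ring: Horner induction in [y], then in [x] on each
    coefficient. *)
Lemma bipoly_ind (K : fieldType) (P : {poly {poly K}} -> Prop) :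
    (forall c, P c%:P%:P) -> P 'X%:P -> P 'X ->
    (forall p q, P p -> P q -> P (p + q)) ->
    (forall p q, P p -> P q -> P (p * q)) ->
  forall p, P p.
Proof.
move=> PC PX PY PD PM; elim/poly_ind => [|p c Pp]; first exact: (PC 0).
apply: (PD) (PM _ _ Pp PY) _; elim/poly_ind: c => [|q c Pq]; first exact: (PC 0).
by rewrite rmorphD rmorphM; apply: PD (PM _ _ Pq PX) (PC c).
Qed.

Lemma psubst_id (K : fieldType) (p : {poly {poly K}}) : psubst p (ridm K) = tofrac p.
Proof.
elim/bipoly_ind: p => [c|||p q hp hq|p q hp hq].
- exact: psubstC.
- exact: psubstX.
- exact: psubstY.
- by rewrite psubstD rmorphD /= hp hq.
- by rewrite psubstM rmorphM /= hp hq.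
Qed.


Section FracRep.
Local Open Scope quotient_scope.
Import FracField.

Lemma frac_repr (R : idomainType) (f : {fraction R}) :
  f = tofrac (frac (repr f)).1 / tofrac (frac (repr f)).2.
Proof.
have d0 := denom_ratioP (repr f).
apply: (canRL (mulfK _)); first by rewrite tofrac_eq0.
rewrite -[f in LHS]reprK; unlock tofrac; rewrite -[LHS]pi_mul.
apply/eqmodP; rewrite /= equivfE /mulf.
by rewrite !numden_Ratio ?mulr1 ?mulf_neq0 ?oner_eq0 ?denom_ratioP // reprK mulrC.
Qed.

Lemma frac_repr_den (R : idomainType) (f : {fraction R}) :
  (frac (repr f)).2 != 0.
Proof. exact: denom_ratioP. Qed.
End FracRep.

(* Without this, [rsubst _ g] may evaluate to the junk value [0 / 0 = 0]. *)
Definition dominant (K : fieldType) (g : ratmap K) :=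
  forall p : {poly {poly K}}, psubst p g = 0 -> p = 0.

(** Makes [rsubst] independent of the chosen representative: two representatives satisfy a
    cross-multiplied polynomial identity, which [psubst] transports, and dominance keeps both
    denominators nonzero. *)
Lemma rsubst_div (K : fieldType) (g : ratmap K) (n d : {poly {poly K}}) :
  dominant g -> d != 0 ->
  rsubst (tofrac n / tofrac d) g = psubst n g / psubst d g.
Proof.
move=> domg d0; set f := _ / _; rewrite /rsubst.
have psubst0 p : p != 0 -> psubst p g != 0 by apply: contra_neq => /domg.
have d'0 := frac_repr_den f.
apply/eqP; rewrite eqr_div ?psubst0 // !psubstE -!rmorphM; apply/eqP; congr (psubst_hom g _).
apply/eqP; rewrite -tofrac_eq !rmorphM /= -eqr_div ?tofrac_eq0 //; apply/eqP.
by rewrite -frac_repr.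
Qed.

Lemma dominant_neq0 (K : fieldType) (g : ratmap K) p : dominant g -> p != 0 -> psubst p g != 0.
Proof. by move=> domg; apply: contra_neq => /domg. Qed.

(* The unused argument carries the dominance hypothesis, which makes [rsubst_dom dg] a canonical
   ring morphism. *)
Definition rsubst_dom (K : fieldType) (g : ratmap K) of dominant g :=
  fun f : RF K => rsubst f g.

Section RsubstHom.
Variables (K : fieldType) (g : ratmap K) (domg : dominant g).

Lemma rsubst_dom_zmod : zmod_morphism (rsubst_dom domg).
Proof.
move=> f1 f2; rewrite /rsubst_dom.
rewrite (frac_repr f1) (frac_repr f2).
move: (frac_repr_den f1) (frac_repr_den f2).
move: (frac _).1 (frac _).2 (frac _).1 (frac _).2 => n1 d1 n2 d2 d10 d20.
rewrite -mulNr -rmorphN addf_div ?tofrac_eq0 // -!rmorphM -rmorphD /=.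
rewrite !rsubst_div ?mulf_neq0 //.
rewrite !psubstE -mulNr addf_div ?dominant_neq0 //.
by rewrite rmorphD !rmorphM rmorphN.
Qed.

Lemma rsubst_dom_monoid : monoid_morphism (rsubst_dom domg).
Proof.
split=> [|f1 f2]; rewrite /rsubst_dom.
  have := rsubst_div 1 domg (oner_neq0 _).
  by rewrite tofrac1 divr1 psubst1 divr1.
rewrite (frac_repr f1) (frac_repr f2).
move: (frac_repr_den f1) (frac_repr_den f2).
move: (frac _).1 (frac _).2 (frac _).1 (frac _).2 => n1 d1 n2 d2 d10 d20.
rewrite mulf_div -!rmorphM /= !rsubst_div ?mulf_neq0 //.
by rewrite !psubstE mulf_div !rmorphM.
Qed.

HB.instance Definition _ :=
  GRing.isZmodMorphism.Build (RF K) (RF K) (rsubst_dom domg) rsubst_dom_zmod.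
HB.instance Definition _ :=
  GRing.isMonoidMorphism.Build (RF K) (RF K) (rsubst_dom domg) rsubst_dom_monoid.

Lemma rsubst_domE f : rsubst f g = rsubst_dom domg f. Proof. by []. Qed.

Lemma rsubst_tofrac p : rsubst_dom domg (tofrac p) = psubst p g.
Proof.
have := rsubst_div p domg (oner_neq0 _).
by rewrite tofrac1 divr1 psubst1 divr1.
Qed.

Lemma rsubst_xF : rsubst_dom domg (xF K) = g.1.
Proof. by rewrite rsubst_tofrac psubstX. Qed.

Lemma rsubst_yF : rsubst_dom domg (yF K) = g.2.
Proof. by rewrite rsubst_tofrac psubstY. Qed.

Lemma rsubst_cstF c : rsubst_dom domg (cstF c) = cstF c.
Proof. by rewrite rsubst_tofrac psubstC. Qed.

Lemma rsubst_psubst p (f : ratmap K) : rsubst (psubst p f) g = psubst p (rcomp f g).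
Proof.
rewrite rsubst_domE; elim/bipoly_ind: p => [c|||p q hp hq|p q hp hq].
- by rewrite !psubstC rsubst_cstF.
- by rewrite !psubstX.
- by rewrite !psubstY.
- by rewrite !psubstD rmorphD /= hp hq.
- by rewrite !psubstM rmorphM /= hp hq.
Qed.

End RsubstHom.
Arguments rsubst_domE {K g} domg f.


Lemma dominant_id (K : fieldType) : dominant (ridm K).
Proof. by move=> p; rewrite psubst_id => /eqP; rewrite tofrac_eq0 => /eqP. Qed.

(** Substituting [g] is a morphism of fields, hence injective on [psubst p f]. *)
Lemma dominant_comp (K : fieldType) (f g : ratmap K) :
  dominant f -> dominant g -> dominant (rcomp f g).
Proof.
move=> domf domg p; rewrite -(rsubst_psubst domg) (rsubst_domE domg) => /eqP.
by rewrite fmorph_eq0 => /eqP /domf.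
Qed.

Lemma rsubst_id (K : fieldType) (f : RF K) : rsubst f (ridm K) = f.
Proof. by rewrite {2}(frac_repr f) /rsubst !psubst_id. Qed.

Lemma rcomp_idr (K : fieldType) (f : ratmap K) : rcomp f (ridm K) = f.
Proof. by case: f => ? ?; rewrite /rcomp !rsubst_id. Qed.

Lemma rsubst_comp (K : fieldType) (h : RF K) (f g : ratmap K) :
  dominant f -> dominant g -> rsubst (rsubst h f) g = rsubst h (rcomp f g).
Proof.
move=> domf domg; rewrite [rsubst h (rcomp _ _)]/rsubst -!(rsubst_psubst domg).
by rewrite [rsubst h f]/rsubst !(rsubst_domE domg) fmorph_div.
Qed.

Lemma rcomp_assoc (K : fieldType) (h f g : ratmap K) :
  dominant f -> dominant g -> rcomp (rcomp h f) g = rcomp h (rcomp f g).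
Proof. by move=> df dg; rewrite /rcomp /= !rsubst_comp. Qed.

Lemma dominant_iter (K : fieldType) (F : ratmap K) n : dominant F -> dominant (riter F n).
Proof. by move=> dF; elim: n => [|n IHn]; [exact: dominant_id | exact: dominant_comp]. Qed.

(** A relation [psubst p g = 0] survives substitution of [f], where it reads [p = 0]. *)
Lemma dominant_rinv (K : fieldType) (f g : ratmap K) :
  dominant f -> rcomp g f = ridm K -> dominant g.
Proof.
move=> df gf p p0; apply: (@dominant_id K).
by rewrite -gf -(rsubst_psubst df) p0 (rsubst_domE df) rmorph0.
Qed.

(** * Values of rational maps at points, and dominance from generic fibres *)

Lemma rval_tofrac (K : fieldType) (p : {poly {poly K}}) z : rval (tofrac p) z (ev2 p z.1 z.2).
Proof.
exists p, 1; rewrite !ev2E !rmorph1 !divr1; split=> //; exact: oner_neq0.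
Qed.

Lemma rvalC (K : fieldType) (c : K) z : rval (cstF c) z c.
Proof. by have := rval_tofrac c%:P%:P z; rewrite ev2C. Qed.

Lemma rvalX (K : fieldType) z : rval (xF K) z z.1.
Proof. by have := rval_tofrac ('X : {poly K})%:P z; rewrite ev2X. Qed.

Lemma rvalY (K : fieldType) z : rval (yF K) z z.2.
Proof. by have := rval_tofrac ('X : {poly {poly K}}) z; rewrite ev2Y. Qed.

Lemma ev2_neq0 (K : fieldType) (d : {poly {poly K}}) (z : K * K) : ev2 d z.1 z.2 != 0 -> d != 0.
Proof. by apply: contra_neq => ->; rewrite ev2E rmorph0. Qed.

Section RvalOps.
Variables (K : fieldType) (z : K * K).
Implicit Types (f g : RF K) (v w : K).

Lemma rvalD f g v w : rval f z v -> rval g z w -> rval (f + g) z (v + w).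
Proof.
move=> [n [d [d0 -> ->]]] [n' [d' [d'0 -> ->]]].
exists (n * d' + n' * d), (d * d'); rewrite ev2D !ev2M mulf_neq0 //; split=> //.
- by rewrite addf_div ?tofrac_eq0 ?(ev2_neq0 d0) ?(ev2_neq0 d'0) // rmorphD !rmorphM.
- by rewrite addf_div.
Qed.

Lemma rvalM f g v w : rval f z v -> rval g z w -> rval (f * g) z (v * w).
Proof.
move=> [n [d [d0 -> ->]]] [n' [d' [d'0 -> ->]]].
exists (n * n'), (d * d'); rewrite !mulf_div.
by rewrite !rmorphM !ev2M mulf_neq0.
Qed.

Lemma rvalN f v : rval f z v -> rval (- f) z (- v).
Proof.
move=> [n [d [d0 -> ->]]]; exists (- n), d.
by rewrite rmorphN ev2N !mulNr.
Qed.

Lemma rvalV f v : v != 0 -> rval f z v -> rval f^-1 z v^-1.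
Proof.
move=> v0 [n [d [d0 -> ve]]]; exists d, n.
rewrite ve !invf_div; split=> //.
by apply: contra_neq v0 => n0; rewrite ve n0 mul0r.
Qed.

Lemma rval_nat n : rval (n%:R : RF K) z n%:R.
Proof. by have := rvalC n%:R z; rewrite rmorph_nat. Qed.

Lemma rvalXn f v n : rval f z v -> rval (f ^+ n) z (v ^+ n).
Proof.
by move=> fv; elim: n => [|n IHn]; [exact: (rval_nat 1) | rewrite !exprS; exact: rvalM].
Qed.

(** Two fractions for [f] satisfy a cross-multiplied identity, which can be evaluated at [z] because
    neither denominator vanishes there. *)
Lemma rval_inj f v w : rval f z v -> rval f z w -> v = w.
Proof.
move=> [n [d [d0 -> ->]]] [n' [d' [d'0 /eqP + ->]]].
rewrite eqr_div ?tofrac_eq0 ?(ev2_neq0 d0) ?(ev2_neq0 d'0) // -!rmorphM tofrac_eq /=.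
by move=> /eqP e; apply/eqP; rewrite eqr_div // -!ev2M e.
Qed.

Lemma rval0 v : rval 0 z v -> v = 0.
Proof. by move/rval_inj; apply; exact: (rval_nat 0). Qed.

Lemma rval_neq0 f v : rval f z v -> v != 0 -> f != 0.
Proof. by move=> fv; apply: contra_neq => f0; apply: rval0; rewrite -f0. Qed.

Lemma rval_psubst (g : ratmap K) (w : K * K) p :
  maps_to g z w -> rval (psubst p g) z (ev2 p w.1 w.2).
Proof.
move=> [g1 g2]; elim/bipoly_ind: p => [c|||p q hp hq|p q hp hq].
- by rewrite psubstC ev2C; apply: rvalC.
- by rewrite psubstX ev2X.
- by rewrite psubstY ev2Y.
- by rewrite psubstD ev2D; apply: rvalD.
- by rewrite psubstM ev2M; apply: rvalM.
Qed.

End RvalOps.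

Lemma poly_horner_eq0 (R : idomainType) (p : {poly R}) :
    injective (fun n : nat => n%:R : R) ->
  (forall n : nat, p.[n%:R] = 0) -> p = 0.
Proof.
move=> natI h; apply/eqP/contraT => p0.
have := max_poly_roots p0 (rs := [seq n%:R | n <- iota 0 (size p)]).
rewrite size_map size_iota ltnn => -> //.
  by apply/allP => _ /mapP [n _ ->]; apply/rootP.
by rewrite map_inj_uniq ?iota_uniq.
Qed.

Lemma ev2_eq0 (K : numFieldType) (p : {poly {poly K}}) :
  (forall a b, ev2 p a b = 0) -> p = 0.
Proof.
have natI : injective (fun n : nat => n%:R : K) by move=> m n /eqP; rewrite eqr_nat => /eqP.
move=> h; apply: poly_horner_eq0 => [m n|n].
  by rewrite -!polyC_natr => /polyC_inj/natI.
by apply: poly_horner_eq0 natI _ => m; have := h m%:R n%:R; rewrite /ev2 polyC_natr.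
Qed.

(** A polynomial [p] killed by [g] vanishes at every value of [g], hence wherever [Q] does not; so
    [p * Q] vanishes everywhere and is zero in characteristic 0. *)
Lemma dominant_generic (K : numFieldType) (g : ratmap K) (Q : {poly {poly K}}) :
  Q != 0 -> (forall w, ev2 Q w.1 w.2 != 0 -> exists z, maps_to g z w) -> dominant g.
Proof.
move=> Q0 h p pg0; apply/eqP; rewrite -(mulIr_eq0 _ (mulIf Q0)); apply/eqP/ev2_eq0 => a b.
have [/= Qab | Qab] := eqVneq (ev2 Q a b) 0; first by rewrite ev2M Qab mulr0.
have [z zw] := h (a, b) Qab; rewrite ev2M.
by have := rval_psubst p zw; rewrite pg0 => /rval0 /= ->; rewrite mul0r.
Qed.

(** * Total degree *)

Section Tdeg.
Variable K : fieldType.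
Implicit Types p q : {poly {poly K}}.

Lemma tdeg_leP p d :
  reflect (forall i j, (d < i + j)%N -> p`_i`_j = 0) (tdeg p <= d)%N.
Proof.
apply: (iffP (bigmax_leqP _ _ _)) => [h i j dij | h i _].
  have [ip | /leq_sizeP/(_ _ (leqnn _)) ->] := ltnP i (size p); last by rewrite coef0.
  have := h (Ordinal ip) isT; case: eqP => [-> | _] /=; first by rewrite coef0.
  move=> le_d; have := leq_ltn_trans le_d dij; rewrite addnC ltn_add2l => lt_j.
  by have /leq_sizeP -> := leq_trans (leqSpred _) lt_j.
case: eqP => // /eqP pi0; rewrite leqNgt; apply/negP => lt_d.
by move: pi0; rewrite -lead_coef_eq0 lead_coefE (h i) ?eqxx // addnC.
Qed.

Lemma tdeg_coef p i j : (tdeg p < i + j)%N -> p`_i`_j = 0.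
Proof. by move: i j; apply/tdeg_leP. Qed.

Lemma tdegD_le p q d : (tdeg p <= d)%N -> (tdeg q <= d)%N -> (tdeg (p + q) <= d)%N.
Proof.
move=> /tdeg_leP hp /tdeg_leP hq; apply/tdeg_leP => i j ij.
by rewrite !coefD hp // hq // addr0.
Qed.

Lemma tdegN p : tdeg (- p) = tdeg p.
Proof.
apply/eqP; rewrite eqn_leq; apply/andP; split; apply/tdeg_leP => i j /tdeg_coef.
  by rewrite !coefN => ->; rewrite oppr0.
by rewrite !coefN => /eqP; rewrite oppr_eq0 => /eqP.
Qed.

Lemma tdegB_le p q d : (tdeg p <= d)%N -> (tdeg q <= d)%N -> (tdeg (p - q) <= d)%N.
Proof. by move=> hp hq; rewrite tdegD_le ?tdegN. Qed.

Lemma tdegM_le p q d e : (tdeg p <= d)%N -> (tdeg q <= e)%N -> (tdeg (p * q) <= d + e)%N.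
Proof.
move=> /tdeg_leP hp /tdeg_leP hq; apply/tdeg_leP => i j ij.
rewrite coefM coef_sum big1 // => -[k /= ki] _; rewrite coefM big1 // => -[l /= lj] _.
have [kl | kl] := ltnP d (k + l); first by rewrite hp ?mul0r.
by rewrite [X in _ * X]hq ?mulr0 //; lia.
Qed.

Lemma tdegXn_le p d n : (tdeg p <= d)%N -> (tdeg (p ^+ n) <= n * d)%N.
Proof.
move=> hp; elim: n => [|n IHn]; last by rewrite exprS mulSn tdegM_le.
by rewrite expr0; apply/tdeg_leP => -[|i] [|j] // _; rewrite coef1 ?coef0 // coef1.
Qed.

Lemma tdeg_nat n : tdeg (n%:R : {poly {poly K}}) = 0%N.
Proof.
apply/eqP; rewrite -leqn0; apply/tdeg_leP => i j ij.
by rewrite -!polyC_natr !coefC; case: i j ij => [|i] [|j] //= _; rewrite ?coefC ?coef0.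
Qed.

Lemma tdegX : (tdeg ('X%:P : {poly {poly K}}) <= 1)%N.
Proof.
by apply/tdeg_leP => -[|[|i]] [|[|j]] //= _; rewrite coefC ?coef0 //= coefX.
Qed.

Lemma tdegY : (tdeg ('X : {poly {poly K}}) <= 1)%N.
Proof.
by apply/tdeg_leP => -[|[|i]] [|[|j]] //= _; rewrite coefX ?coef0 //= coef1.
Qed.

(** The leading coefficient of [p] in [y] is a nonzero polynomial in [x], and it reappears in
    [p * 'X^m] at a [y]-exponent of at least [m]. *)
Lemma leq_tdeg_mulXn p m : p != 0 -> (m <= tdeg (p * 'X^m))%N.
Proof.
rewrite leqNgt -lead_coef_eq0; apply: contra => lt_m; apply/eqP/polyP => j.
rewrite coef0 lead_coefE; set k := (size p).-1.
have <- : (p * 'X^m)`_(k + m) = p`_k by rewrite coefMXn ltnNge leq_addl addnK.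
by rewrite tdeg_coef //; lia.
Qed.
End Tdeg.

(** ['X] is prime and does not divide [B], so its powers can be stripped from [N] one at a time. *)
Lemma dvdXn_coef0_neq0 (R : idomainType) (M N B : {poly R}) m :
  M * 'X^m = N * B -> B`_0 != 0 -> exists N', N = N' * 'X^m.
Proof.
move=> + B0; elim: m N => [|m IHm] N e; first by exists N; rewrite mulr1.
elim/poly_ind: N e => [|N c _] e; first by exists 0; rewrite mul0r.
have /eqP : (M * 'X^(m.+1))`_0 = 0 by rewrite coefMXn.
rewrite e coef0M coefD coefMX coefC /= add0r mulf_eq0 (negPf B0) orbF => /eqP c0.
have /IHm [N1 ->] : M * 'X^m = N * B.
  by apply: (mulIf (negbT (polyX_eq0 R))); rewrite -mulrA -exprSr e c0 addr0 mulrAC.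
by exists N1; rewrite c0 addr0 exprSr mulrA.
Qed.

(** * Limits of [n]-th roots *)

Section Limits.
Variable R : realType.
Local Open Scope classical_set_scope.
Import numFieldNormedType.Exports.

Lemma cvg_powR_inv (c : R) : 0 < c ->
  (fun n : nat => c `^ n%:R^-1) @ \oo --> (1 : R).
Proof.
move=> c0; have -> : (fun n : nat => c `^ n%:R^-1) = (fun n : nat => expR (n%:R^-1 * ln c)).
  by apply/funext => n; rewrite /powR gt_eqF.
have h : (fun n : nat => n%:R^-1 * ln c) @ \oo --> (0 * ln c : R).
  apply: cvgM; last exact: cvg_cst.
  (* Shifting the index avoids the default value [0^-1 = 0] and leaves the harmonic sequence. *)
  by rewrite -(cvg_shiftS (fun n : nat => n%:R^-1 : R)); exact: cvg_harmonic.
have := cvg_comp _ _ h (@continuous_expR R _).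
by rewrite mul0r expR0.
Qed.

(** The constants [c^-1] and [c] have [n]-th roots tending to 1, so both bounds tend to [b]. *)
Lemma cvg_root_sandwich (a : nat -> nat) (c b : R) : 0 < c ->
    (forall n, c^-1 * b ^+ n <= (a n)%:R <= c * b ^+ n) -> 0 < b ->
  (fun n : nat => ((a n)%:R : R) `^ n%:R^-1) @ \oo --> b.
Proof.
move=> c0 h b0; have [c0' b0'] := (ltW c0, ltW b0).
have bE (n : nat) : (0 < n)%N -> (b ^+ n) `^ n%:R^-1 = b.
  move=> n0; rewrite -powR_mulrn ?ltW // -powRrM mulfV ?powRr1 ?ltW //.
  by rewrite pnatr_eq0 -lt0n.
apply: (@squeeze_cvgr _ _ _ _ (fun n : nat => (c^-1) `^ n%:R^-1 * b) (fun n : nat => c `^ n%:R^-1 * b)).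
(* Positivity of [n] matters: at [n = 0] the exponent is [0^-1 = 0] and the root is 1 instead of
   [b]. *)
- near=> n; have n0 : (0 < n)%N by near: n; exists 1%N.
  have /andP[h1 h2] := h n.
  have cb : 0 <= c^-1 * b ^+ n by rewrite mulr_ge0 ?invr_ge0 ?exprn_ge0.
  rewrite -{1 2}(bE n n0) -!powRM ?invr_ge0 ?exprn_ge0 //.
  by apply/andP; split; apply: ge0_ler_powR;
    rewrite ?nnegrE ?invr_ge0 ?(le_trans cb h1) // (le_trans (le_trans cb h1) h2).
- have ci0 : 0 < c^-1 by rewrite invr_gt0.
  by have := cvgM (cvg_powR_inv ci0) (cvg_cst b); rewrite mul1r; apply.
- by have := cvgM (cvg_powR_inv c0) (cvg_cst b); rewrite mul1r; apply.
Unshelve. all: by end_near.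
Qed.
End Limits.

(** * The conjugacy *)

Section Conjugacy.
Variable E : fieldType.
Implicit Types x y u v : E.

(* These maps are used at points of [K * K] as well as at the generic point [(xF K, yF K)], with
   [E] the function field. *)
Definition Fden x y := (x - 1 - y) * (x ^+ 2 - 1 + y - y ^+ 2).
Definition Fmap (z : E * E) : E * E :=
  (z.1 + 2 * z.2 ^+ 2 * (- z.1 ^+ 2 + z.1 + z.2 ^+ 2) / Fden z.1 z.2,
   z.2 ^+ 2 * (z.1 - 1 + z.2) / Fden z.1 z.2).
Definition wmap (z : E * E) : E * E :=
  ((z.1 ^+ 2 - 1 - z.1 * z.2 - 2 * z.2 ^+ 2) / z.2,
   (1 + z.1 - 2 * z.2) * (1 + z.1 + z.2) / (2 * z.2)).
Definition Gmap (z : E * E) : E * E :=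
  (z.1 ^+ 2 - z.1 - 3, (z.1 - 1) * (z.1 + 2) / (z.1 + 3) * z.2).
Definition winv (z : E * E) : E * E :=
  let y := 8 * z.2 / ((2 * z.2 - z.1) ^+ 2 - 9) in ((2 * z.2 - z.1 + 1) / 2 * y - 1, y).

Hypothesis two_neq0 : 2 != 0 :> E.

Lemma eight_neq0 : 8 != 0 :> E.
Proof. by rewrite (_ : 8 = 2 * 2 * 2) ?mulf_neq0 //; ring. Qed.

Lemma wmapKden x y : y != 0 ->
  (2 * (wmap (x, y)).2 - (wmap (x, y)).1) ^+ 2 - 9 = 8 * (wmap (x, y)).2 / y.
Proof. by move=> y0; rewrite /=; field; rewrite ?two_neq0 y0. Qed.

Lemma wmapK x y : y != 0 -> (wmap (x, y)).2 != 0 -> winv (wmap (x, y)) = (x, y).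
Proof.
move=> y0 v0; have e8 := eight_neq0.
have yE : (winv (wmap (x, y))).2 = y.
  rewrite [LHS](_ : _ = 8 * (wmap (x, y)).2 / ((2 * (wmap (x, y)).2 - (wmap (x, y)).1) ^+ 2 - 9)) //.
  by rewrite wmapKden //; move: v0; set v := (wmap _).2 => v0; field; rewrite ?two_neq0 y0 v0 e8.
(* Once [y] is known, [x] follows from the relation [2 v - u + 1 = 2 (x + 1) / y]. *)
rewrite [LHS]surjective_pairing yE; congr (_, _).
rewrite [LHS](_ : _ = (2 * (wmap (x, y)).2 - (wmap (x, y)).1 + 1) / 2 * (winv (wmap (x, y))).2 - 1) //.
by rewrite yE /=; field; rewrite two_neq0 y0.
Qed.

Lemma winvK u v : v != 0 -> (2 * v - u) ^+ 2 - 9 != 0 -> wmap (winv (u, v)) = (u, v).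
Proof.
move=> v0 d0; have e8 := eight_neq0.
by rewrite /wmap /winv /=; congr (_, _); field; rewrite ?two_neq0 ?v0 ?d0 ?e8.
Qed.

(** Shows that [u + 3 != 0] excludes exactly the zeros of [x - 1 + y] and [x + 1 - 2 * y], the extra
    denominators met in the conjugacy. *)
Lemma wmap_add3 x y : y != 0 ->
  (wmap (x, y)).1 + 3 = (x - 1 + y) * (x + 1 - 2 * y) / y.
Proof. by move=> y0; rewrite /=; field. Qed.

(** With [wmap_Fden2], rewrites the two factors of [Fden] in the coordinates [(u, v)], where their
    vanishing can be compared with the target [(U, V)]. *)
Lemma wmap_Fden1 x y : y != 0 -> let u := (wmap (x, y)).1 in let v := (wmap (x, y)).2 in
  4 * v * (x - 1 - y) = y * (2 * v * (u - 1) - (u ^+ 2 - 9)).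
Proof. by move=> y0 /=; field; rewrite ?two_neq0 y0. Qed.

Lemma wmap_Fden2 x y : y != 0 -> let u := (wmap (x, y)).1 in let v := (wmap (x, y)).2 in
  2 * (1 + x - 2 * y) * (x ^+ 2 - 1 + y - y ^+ 2) = y ^+ 2 * (2 * v * (u + 2) - u * (u + 3)).
Proof. by move=> y0 /=; field; rewrite ?two_neq0 y0. Qed.

Lemma wmap_Fmap1 x y : y != 0 -> Fden x y != 0 -> x - 1 + y != 0 ->
  (wmap (Fmap (x, y))).1 = (Gmap (wmap (x, y))).1.
Proof.
rewrite /Fden mulf_eq0 negb_or => y0 /andP[d1 d2] e0; rewrite /= /Fden.
by field; rewrite ?two_neq0 y0 d1 d2 e0.
Qed.

Lemma wmap_Fmap2 x y : y != 0 -> Fden x y != 0 -> x - 1 + y != 0 -> x + 1 - 2 * y != 0 ->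
  (wmap (Fmap (x, y))).2 = (Gmap (wmap (x, y))).2.
Proof.
rewrite /Fden mulf_eq0 negb_or => y0 /andP[d1 d2] e0 f0.
rewrite [RHS](_ : _ = ((wmap (x, y)).1 - 1) * ((wmap (x, y)).1 + 2) / ((wmap (x, y)).1 + 3)
  * (wmap (x, y)).2) // wmap_add3 //= /Fden.
by field; rewrite ?two_neq0 y0 d1 d2 e0 f0.
Qed.

Lemma wmap_Fmap x y : y != 0 -> Fden x y != 0 -> (Fmap (x, y)).2 != 0 -> (wmap (x, y)).1 + 3 != 0 ->
  wmap (Fmap (x, y)) = Gmap (wmap (x, y)).
Proof.
move=> y0 d0; rewrite [X in X != _]/= !mulf_eq0 !negb_or => /andP[/andP[_ e0] _].
rewrite wmap_add3 // !mulf_eq0 !negb_or => /andP[/andP[_ f0] _].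
by rewrite [LHS]surjective_pairing [RHS]surjective_pairing wmap_Fmap1 ?wmap_Fmap2.
Qed.

End Conjugacy.

(** * Fibres of the map over good targets *)

Section Fiber.
Variable E : fieldType.
Hypothesis two_neq0 : 2 != 0 :> E.

Definition Fpre (w : E * E) (u : E) : E * E :=
  winv (u, (wmap w).2 * (u + 3) / ((u - 1) * (u + 2))).

(* Here [U, V] are the coordinates [wmap w]; the last two factors are resultants eliminating [u]
   from [u ^+ 2 - u - 3 = U] and the vanishing of the denominator of [winv] in [Fpre]. *)
Definition good_target (w : E * E) :=
  let U := (wmap w).1 in let V := (wmap w).2 in
  [/\ w.2 != 0, V != 0, [/\ U - 9 != 0, U + 3 != 0 & U - 3 != 0],
      2 * V - U - 3 != 0 /\ 2 * V - U + 3 != 0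
    & (2 * V - U - 1) ^+ 2 - 2 * (2 * V - U - 1) - 12 - 4 * U != 0 /\
      (6 * V + U - 3) ^+ 2 - (6 * V + U - 3) * (U - 3 - 2 * V)
        - (3 + U) * (U - 3 - 2 * V) ^+ 2 != 0].

(** The values [-3], [1], [-2] of [u], where the multiplier of [Gmap] has its pole and zeros, are
    sent to [U = 9], [-3], [3]. *)
Lemma root_neq (U u : E) : u ^+ 2 - u - 3 = U -> U - 9 != 0 -> U + 3 != 0 -> U - 3 != 0 ->
  [/\ u + 3 != 0, u - 1 != 0 & u + 2 != 0].
Proof.
move=> <- h1 h2 h3; split.
- by apply: contra_neq h1 => e; rewrite [LHS](_ : _ = (u + 3) * (u - 4)); [by rewrite e mul0r | by ring].
- by apply: contra_neq h2 => e; rewrite [LHS](_ : _ = (u - 1) * u); [by rewrite e mul0r | by ring].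
- by apply: contra_neq h3 => e; rewrite [LHS](_ : _ = (u + 2) * (u - 3)); [by rewrite e mul0r | by ring].
Qed.

(** Since [w.2 != 0], the point [z] avoids [y = 0] and [x - 1 + y = 0]. The conjugacy then
    determines [wmap z] from [u], and [wmapK] recovers [z]. *)
Lemma Fmap_fiberP w z : good_target w -> Fden z.1 z.2 != 0 -> Fmap z = w ->
  exists2 u, u ^+ 2 - u - 3 = (wmap w).1 & z = Fpre w u.
Proof.
rewrite /Fpre; case: z => x y; rewrite [(x, y).1]/= [(x, y).2]/= => + d0 Fw; rewrite -{w}Fw.
case=> b0 V0 [U9 U3 U3'] _ _.
have y0 : y != 0 by apply: contra_neq b0 => y0; rewrite /= y0 expr0n !mul0r.
have e0 : x - 1 + y != 0 by apply: contra_neq b0 => e; rewrite /= e mulr0 mul0r.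
have UE : (wmap (x, y)).1 ^+ 2 - (wmap (x, y)).1 - 3 = (wmap (Fmap (x, y))).1.
  by rewrite wmap_Fmap1.
have [u3 u1 u2] := root_neq UE U9 U3 U3'.
exists (wmap (x, y)).1 => //.
set v := _ * _ / _.
have vE : v = (wmap (x, y)).2.
  rewrite /v wmap_Fmap //; move: u1 u2 u3; rewrite [wmap _]surjective_pairing.
  move: (wmap _).1 (wmap _).2 => u v' u1 u2 u3.
  by rewrite /Gmap /=; field; rewrite u1 u2 u3.
have v0 : v != 0 by apply: mulf_neq0; [exact: mulf_neq0 | rewrite invr_eq0; exact: mulf_neq0].
by rewrite vE -surjective_pairing wmapK // -vE.
Qed.

Lemma Fpre_fiber w u : good_target w -> u ^+ 2 - u - 3 = (wmap w).1 ->
  [/\ Fden (Fpre w u).1 (Fpre w u).2 != 0, Fmap (Fpre w u) = w & (wmap (Fpre w u)).1 = u].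
Proof.
case: w => a b; rewrite /good_target /Fpre.
case Uw : (wmap (a, b)) => [U V]; rewrite [(U, V).1]/= [(U, V).2]/=.
case=> b0 V0 [U9 U3 U3'] [c1 c2] [c3 c4] UE.
have [u3 u1 u2] := root_neq UE U9 U3 U3'.
set v := _ / _.
have vE : v * ((u - 1) * (u + 2)) = V * (u + 3) by rewrite mulfVK ?mulf_neq0.
have v0 : v != 0 by apply: mulf_neq0; [exact: mulf_neq0 | rewrite invr_eq0; exact: mulf_neq0].
(* The denominator of [winv] splits into two linear factors, each excluded by one of the resultants
   [c3] and [c4]. *)
have d0 : (2 * v - u) ^+ 2 - 9 != 0.
  rewrite [X in X != _](_ : _ = (2 * v - u - 3) * (2 * v - u + 3)); last by ring.
  rewrite mulf_neq0 //.
    apply: contra_neq c3 => e.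
    have : (u + 3) * (2 * V - (u - 1) * (u + 2)) = 0.
      rewrite mulrBr mulrCA [_ * V]mulrC -vE.
      rewrite [LHS](_ : _ = (2 * v - u - 3) * ((u - 1) * (u + 2))); last by ring.
      by rewrite e mul0r.
    move/eqP; rewrite mulf_eq0 (negPf u3) /= => /eqP k0.
    (* The resultant is a norm: the second factor is the first one at the other root [1 - u],
       reduced modulo [u ^+ 2 - u - 3 = U]. *)
    rewrite -UE [LHS](_ : _ =
      (2 * V - (u - 1) * (u + 2)) * (2 * V - (u - 1) * (u + 2) + 4 * u - 2)); last by ring.
    by rewrite k0 mul0r.
  apply: contra_neq c4 => e.
  have k0 : 2 * (V * (u + 3)) - (u - 3) * (u - 1) * (u + 2) = 0.
    rewrite -vE [LHS](_ : _ = (2 * v - u + 3) * ((u - 1) * (u + 2))); last by ring.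
    by rewrite e mul0r.
  (* Again a norm. Modulo the quadratic, the first factor is [(6 V + U - 3) - (U - 3 - 2 V) u], and
     the second is its conjugate under [u] to [1 - u]. *)
  rewrite -UE [LHS](_ : _ = (2 * (V * (u + 3)) - (u - 3) * (u - 1) * (u + 2)) *
    (6 * V + (u ^+ 2 - u - 3) - 3 + (u - 1) * ((u ^+ 2 - u - 3) - 3 - 2 * V))); last by ring.
  by rewrite k0 mul0r.
have [x [y zE]] : exists x y, winv (u, v) = (x, y) by eexists; eexists; apply: surjective_pairing.
have wz : wmap (x, y) = (u, v) by rewrite -zE winvK.
have y0 : y != 0.
  have -> : y = (winv (u, v)).2 by rewrite zE.
  apply: mulf_neq0; last by rewrite invr_eq0.
  by apply: mulf_neq0 => //; apply: eight_neq0.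
have e0 : x - 1 + y != 0.
  have := u3; rewrite -[u]/((u, v).1) -wz wmap_add3 // !mulf_eq0 !negb_or.
  by case/andP => /andP[].
(* Multiplying by [u + 3] turns the vanishing of either factor of [Fden] into a linear relation
   between [U] and [V], excluded by [c2] or [c1]. *)
have D0 : Fden x y != 0.
  rewrite /Fden mulf_neq0 //.
    apply: contra_neq c2 => e.
    have := wmap_Fden1 two_neq0 x y0; rewrite wz /= e mulr0 => /esym/eqP.
    rewrite mulf_eq0 (negPf y0) /= => /eqP e1.
    have /eqP : (u + 3) * (2 * V - U + 3) = 0.
      rewrite [LHS](_ : _ = 2 * (V * (u + 3)) - (u + 3) * (U - 3)); last by ring.
      rewrite -vE -UE [LHS](_ : _ = (2 * v * (u - 1) - (u ^+ 2 - 9)) * (u + 2)); last by ring.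
      by rewrite e1 mul0r.
    by rewrite mulf_eq0 (negPf u3) => /eqP.
  apply: contra_neq c1 => e.
  have := wmap_Fden2 two_neq0 x y0; rewrite wz /= e mulr0 => /esym/eqP.
  rewrite mulf_eq0 expf_eq0 (negPf y0) /= => /eqP e1.
  have /eqP : (u + 3) * (2 * V - U - 3) = 0.
    rewrite [LHS](_ : _ = 2 * (V * (u + 3)) - (u + 3) * (U + 3)); last by ring.
    rewrite -vE -UE [LHS](_ : _ = (2 * v * (u + 2) - u * (u + 3)) * (u - 1)); last by ring.
    by rewrite e1 mul0r.
  by rewrite mulf_eq0 (negPf u3) => /eqP.
have b'0 : (Fmap (x, y)).2 != 0 by rewrite !mulf_neq0 ?invr_eq0 // expf_neq0.
have wF : wmap (Fmap (x, y)) = (U, V).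
  rewrite wmap_Fmap ?wz // /Gmap; congr (_, _); first exact: UE.
  by rewrite [(u, v).1]/= [(u, v).2]/= /v; field; rewrite u1 u2 u3.
have VF : (wmap (Fmap (x, y))).2 != 0 by rewrite wF.
rewrite zE; split; rewrite ?wz //.
(* Both [(a, b)] and the image of [(x, y)] have [wmap] equal to [(U, V)] and lie where [winv]
   inverts [wmap], so they coincide. *)
have -> : (a, b) = winv (U, V) by rewrite -Uw wmapK // Uw.
by rewrite -wF; case: (Fmap (x, y)) b'0 VF => a' b' *; rewrite wmapK.
Qed.

End Fiber.

(* The conditions of [good_target], and the discriminant of [u ^+ 2 - u - 3 = U], cleared of
   denominators: here [p = U b] and [q = 2 V b]. *)
Definition target_disc (T : comNzRingType) (p q b : T) : T :=
  b * q * (p - 9 * b) * (p + 3 * b) * (p - 3 * b) * (q - p - 3 * b) * (q - p + 3 * b)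
  * ((q - p - b) ^+ 2 - 2 * (q - p - b) * b - 12 * b ^+ 2 - 4 * p * b)
  * ((3 * q + p - 3 * b) ^+ 2 * b - (3 * q + p - 3 * b) * (p - 3 * b - q) * b
     - (3 * b + p) * (p - 3 * b - q) ^+ 2)
  * (4 * p + 13 * b).

Definition bad_locus (T : comNzRingType) (a b : T) : T :=
  target_disc (a ^+ 2 - 1 - a * b - 2 * b ^+ 2) ((1 + a - 2 * b) * (1 + a + b)) b.

Lemma ev2_target_disc (K : fieldType) p q b (z : K * K) :
  ev2 (target_disc p q b) z.1 z.2 =
  target_disc (ev2 p z.1 z.2) (ev2 q z.1 z.2) (ev2 b z.1 z.2).
Proof. by rewrite /target_disc !ev2_simpl. Qed.

Lemma ev2_bad_locus (K : fieldType) (z : K * K) :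
  ev2 (bad_locus 'X%:P 'X) z.1 z.2 = bad_locus z.1 z.2.
Proof. by rewrite /bad_locus ev2_target_disc !ev2_simpl. Qed.

Lemma good_target_disc (E : fieldType) (w : E * E) : 2 != 0 :> E ->
  bad_locus w.1 w.2 != 0 -> good_target w /\ 4 * (wmap w).1 + 13 != 0.
Proof.
move=> e2; case: w => a b; rewrite [(a, b).1]/= [(a, b).2]/=.
rewrite /bad_locus; set p := _ - _; set q := (_ * _ in X in target_disc _ X).
have [-> | b0] := eqVneq b 0; first by rewrite /target_disc !mul0r eqxx.
have pE : p = (wmap (a, b)).1 * b by rewrite /= mulfVK.
have qE : q = 2 * (wmap (a, b)).2 * b by rewrite /= -/q; field; rewrite e2 b0.
rewrite /good_target; move: pE qE; move: (wmap _).1 (wmap _).2 p q => U V p q pE qE.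
rewrite /target_disc !mulf_eq0 !negb_or -!andbA.
case/and5P => _ q0 f1 f2 /and5P [f3 f4 f5 f6 /andP[f7 f8]].
move: q0 f1 f2 f3 f4 f5 f6 f7 f8; rewrite pE qE => q0 f1 f2 f3 f4 f5 f6 f7 f8.
do ![split]; rewrite //.
- by apply: contra_neq q0 => ->; rewrite mulr0 mul0r.
- by apply: contra_neq f1; rewrite -mulrBl => ->; rewrite mul0r.
- by apply: contra_neq f2; rewrite -mulrDl => ->; rewrite mul0r.
- by apply: contra_neq f3; rewrite -mulrBl => ->; rewrite mul0r.
- by apply: contra_neq f4; rewrite -!mulrBl => ->; rewrite mul0r.
- by apply: contra_neq f5; rewrite -mulrBl -mulrDl => ->; rewrite mul0r.
- apply: contra_neq f6 => e; rewrite [LHS](_ : _ =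
    ((2 * V - U - 1) ^+ 2 - 2 * (2 * V - U - 1) - 12 - 4 * U) * b ^+ 2); last by ring.
  by rewrite e mul0r.
- apply: contra_neq f7 => e; rewrite [LHS](_ : _ =
    ((6 * V + U - 3) ^+ 2 - (6 * V + U - 3) * (U - 3 - 2 * V)
        - (3 + U) * (U - 3 - 2 * V) ^+ 2) * b ^+ 3); last by ring.
  by rewrite e mul0r.
- by apply: contra_neq f8 => e; rewrite mulrA -mulrDl e mul0r.
Qed.

Ltac rval_tac := repeat first
  [ exact: rvalX | exact: rvalY | exact: rval_nat | exact: (rval_nat _ 1) | apply: rvalD
  | apply: rvalN | apply: rvalXn | apply: rvalM | apply: rvalV ].

(** * The coordinate change as a birational map *)

Section Geometry.
Variable K : numFieldType.
Local Notation x := (xF K).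
Local Notation y := (yF K).

Lemma two_neq0 : 2 != 0 :> K. Proof. by rewrite pnatr_eq0. Qed.

Lemma RF_nat_neq0 n : n.+1%:R != 0 :> RF K.
Proof. by apply: (rval_neq0 (rval_nat (0, 0) _)); rewrite pnatr_eq0. Qed.

Lemma maps_to_Fmap z : Fden z.1 z.2 != 0 -> maps_to (Fmap (x, y)) z (Fmap z).
Proof. by move=> z0; split; rewrite /Fmap /= /Fden; rval_tac. Qed.

Lemma maps_to_wmap z : z.2 != 0 -> maps_to (wmap (x, y)) z (wmap z).
Proof. by move=> z0; split; rewrite /wmap /=; rval_tac; rewrite ?mulf_neq0 ?two_neq0. Qed.

Lemma RF_winv_den_neq0 : (2 * y - x) ^+ 2 - 9 != 0.
Proof.
apply: (@rval_neq0 _ (0, 0) _ ((2 * 0 - 0) ^+ 2 - 9)); first by rval_tac.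
by rewrite mulr0 subr0 expr0n sub0r oppr_eq0 pnatr_eq0.
Qed.

Lemma RF_y_neq0 : y != 0.
Proof. by apply: (rval_neq0 (rvalY (0, 1))); rewrite oner_neq0. Qed.

Lemma RF_wmap2_neq0 : (wmap (x, y)).2 != 0.
Proof.
have [_ h] := maps_to_wmap (oner_neq0 K : (0, 1).2 != 0).
apply: (rval_neq0 h); rewrite /= !mulf_neq0 ?invr_eq0 ?mulf_neq0 ?two_neq0 ?oner_neq0 //.
Qed.

(** Off the zero set of [Q], the point [winv (u, v)] is a preimage of [(u, v)]. *)
Lemma dominant_wmap : dominant (wmap (x, y)).
Proof.
pose Q : {poly {poly K}} := 'X * ((2 * 'X - 'X%:P) ^+ 2 - 9).
have QE a b : ev2 Q a b = b * ((2 * b - a) ^+ 2 - 9).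
  by rewrite /Q !ev2_simpl.
apply: (@dominant_generic _ _ Q) => [|[u v]].
  apply/eqP => Q0; have := QE 0 1; rewrite Q0 ev2E rmorph0 => /esym/eqP.
  by rewrite (_ : _ * _ = - 5) ?oppr_eq0 ?pnatr_eq0 //; ring.
rewrite QE mulf_eq0 negb_or => /andP[/= v0 d0]; exists (winv (u, v)).
rewrite -[X in maps_to _ _ X](winvK two_neq0 v0 d0); apply: maps_to_wmap.
by rewrite /winv /= !mulf_neq0 ?invr_eq0 // pnatr_eq0.
Qed.

(** Composition with a dominant [g] is a field morphism, so it amounts to evaluating the formula of
    [wmap] at [g]; the field identities above then apply over the function field. *)
Lemma rcomp_wmap (g : ratmap K) : dominant g -> rcomp (wmap (x, y)) g = wmap g.
Proof.
move=> dg; rewrite /rcomp !(rsubst_domE dg) /wmap /=.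
by rewrite !(rmorph_nat, rmorphXn, rmorphD, rmorphM, rmorphN, fmorphV, rmorph1) /= rsubst_xF rsubst_yF.
Qed.

Lemma rcomp_Gmap (g : ratmap K) : dominant g -> rcomp (Gmap (x, y)) g = Gmap g.
Proof.
move=> dg; rewrite /rcomp !(rsubst_domE dg) /Gmap /=.
by rewrite !(rmorph_nat, rmorphXn, rmorphD, rmorphM, rmorphN, fmorphV, rmorph1) /= rsubst_xF rsubst_yF.
Qed.

Lemma rcomp_winv (g : ratmap K) : dominant g -> rcomp (winv (x, y)) g = winv g.
Proof.
move=> dg; rewrite /rcomp !(rsubst_domE dg) /winv /=.
by rewrite !(rmorph_nat, rmorphXn, rmorphD, rmorphM, rmorphN, fmorphV, rmorph1) /= rsubst_xF rsubst_yF.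
Qed.

Lemma rcomp_winv_wmap : rcomp (winv (x, y)) (wmap (x, y)) = ridm K.
Proof.
rewrite (rcomp_winv dominant_wmap).
exact: (wmapK (RF_nat_neq0 1) RF_y_neq0 RF_wmap2_neq0).
Qed.

Lemma dominant_winv : dominant (winv (x, y)).
Proof. exact: dominant_rinv dominant_wmap rcomp_winv_wmap. Qed.

Lemma rcomp_wmap_winv : rcomp (wmap (x, y)) (winv (x, y)) = ridm K.
Proof.
rewrite (rcomp_wmap dominant_winv).
exact: (winvK (RF_nat_neq0 1) RF_y_neq0 RF_winv_den_neq0).
Qed.
End Geometry.

(** * Topological degree *)

Lemma RF_Fden_neq0 (K : fieldType) : Fden (xF K) (yF K) != 0.
Proof.
apply: (@rval_neq0 _ (0, 0) _ (Fden 0 0)); first by rewrite /Fden; rval_tac.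
by rewrite (_ : Fden 0 0 = 1) ?oner_neq0 // /Fden; ring.
Qed.

(** On [b = 0] the denominator is [(a - 1) ^+ 2 * (a + 1)], and on [a = 1 - b] it is
    [2 * b ^+ 2]. *)
Lemma Fmap_common_zero (K : fieldType) (a b : K) : 2 != 0 :> K ->
  Fden a b = 0 -> b ^+ 2 * (a - 1 + b) = 0 -> (a, b) = (1, 0) \/ (a, b) = (- 1, 0).
Proof.
move=> e2 + /eqP; rewrite mulf_eq0 expf_eq0 /= => d /orP[/eqP b0 | /eqP ab].
  move: d; rewrite b0.
  rewrite (_ : Fden a 0 = (a - 1) ^+ 2 * (a + 1)); last by rewrite /Fden; ring.
  move/eqP; rewrite mulf_eq0 expf_eq0 /= subr_eq0 addr_eq0.
  by case/orP => /eqP ->; [left | right].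
have aE : a = 1 - b by apply/eqP; rewrite -subr_eq0 -ab; apply/eqP; ring.
move: d; rewrite aE (_ : Fden _ b = 2 * b ^+ 2); last by rewrite /Fden; ring.
by move/eqP; rewrite mulf_eq0 (negPf e2) expf_eq0 => /eqP ->; left; rewrite subr0.
Qed.

Section TopologicalDegree.
Variable K : numClosedFieldType.
Local Notation F := (Fmap (xF K, yF K)).

(** A value of the second component times [Fden z] is the value of the numerator; if [Fden] vanished
    at [z], the numerator would too, forcing a common zero. *)
Lemma maps_to_FmapE z w : maps_to F z w -> z != (1, 0) -> z != (- 1, 0) ->
  Fden z.1 z.2 != 0 /\ Fmap z = w.
Proof.
move=> [h1 h2] z1 z2.
have D0 : Fden z.1 z.2 != 0.
  have hD : rval (Fden (xF K) (yF K)) z (Fden z.1 z.2) by rewrite /Fden; rval_tac.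
  have hN : rval (yF K ^+ 2 * (xF K - 1 + yF K)) z (z.2 ^+ 2 * (z.1 - 1 + z.2)) by rval_tac.
  have := rvalM h2 hD; rewrite [F.2 * _]mulfVK ?RF_Fden_neq0 // => /(rval_inj hN) e.
  apply/eqP => d0; move: e; rewrite d0 mulr0 => /(Fmap_common_zero (two_neq0 K) d0).
  by rewrite -surjective_pairing => -[] zE; move: z1 z2; rewrite zE eqxx.
split=> //; have [k1 k2] := maps_to_Fmap D0.
by rewrite [RHS]surjective_pairing (rval_inj h1 k1) (rval_inj h2 k2) -surjective_pairing.
Qed.

Lemma excluded_value z : exists c : K, forall w, maps_to F z w -> w.1 = c.
Proof.
have [[w [h _]] | no] := pselect (exists w, maps_to F z w).
  by exists w.1 => w' [h' _]; exact: rval_inj h' h.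
by exists 0 => w h; case: no; exists w.
Qed.

Lemma bad_locus_neq0 : bad_locus 'X%:P 'X != 0 :> {poly {poly K}}.
Proof.
have n0 n : n.+1%:R != 0 :> K by rewrite pnatr_eq0.
(* At [(0, 2)] one has [p = q = -9] and [b = 2], and no factor of [target_disc] vanishes. *)
apply: (@ev2_neq0 _ _ (0, 2)); rewrite ev2_bad_locus /bad_locus /=.
rewrite (_ : _ - 2 * 2 ^+ 2 = - 9); last by ring.
rewrite (_ : _ * _ = - 9); last by ring.
rewrite /target_disc !mulf_neq0 ?oppr_eq0 ?n0 //.
  by rewrite (_ : _ - _ = 36) ?n0 //; ring.
by rewrite (_ : _ - _ = 3132) ?n0 //; ring.
Qed.

Lemma topdeg_Fmap : topdeg_is F 2.
Proof.
have [c1 hc1] := excluded_value (1, 0); have [c2 hc2] := excluded_value (- 1, 0).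
(* The exceptional curve is the bad locus together with the two vertical lines through the possible
   values at [(1, 0)] and [(-1, 0)]. *)
have e2 := two_neq0 K.
exists (bad_locus 'X%:P 'X * ('X%:P - c1%:P%:P) * ('X%:P - c2%:P%:P)); split.
  have lin c : 'X%:P - c%:P%:P != 0 :> {poly {poly K}} by rewrite -polyCB polyC_eq0 polyXsubC_eq0.
  by apply: mulf_neq0 => //; apply: mulf_neq0 => //; exact: bad_locus_neq0.
move=> w; rewrite 2!ev2M ev2_bad_locus 2!mulf_eq0 2!negb_or -!andbA !ev2_simpl !subr_eq0.
case/and3P => /(good_target_disc e2)[good]; set d := _ + 13 => d0 w1 w2.
(* [d = 4 U + 13] is the discriminant of [u ^+ 2 - u - 3 = U], so the roots are [(1 + s) / 2] and
   [(1 - s) / 2]. *)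
pose s := sqrtC d; have s2 : s ^+ 2 = d by apply: sqrtCK.
have s0 : s != 0 by rewrite sqrtC_eq0.
have rootE u : u ^+ 2 - u - 3 = (wmap w).1 <-> u = (1 + s) / 2 \/ u = (1 - s) / 2.
  have facE : 4 * (u ^+ 2 - u - 3 - (wmap w).1) = 4 * ((u - (1 + s) / 2) * (u - (1 - s) / 2)).
    transitivity (4 * (u ^+ 2 - u) + 1 - s ^+ 2); first by rewrite s2 /d; ring.
    by field.
  have /mulfI e4 : 4 != 0 :> K by rewrite pnatr_eq0.
  move/e4: facE => facE; split.
    move/eqP; rewrite -subr_eq0 facE mulf_eq0 !subr_eq0.
    by case/orP => /eqP; [left | right].
  by move=> h; apply/eqP; rewrite -subr_eq0 facE mulf_eq0 !subr_eq0; case: h => ->; rewrite eqxx ?orbT.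
have preP u : u = (1 + s) / 2 \/ u = (1 - s) / 2 ->
    maps_to F (Fpre w u) w /\ (wmap (Fpre w u)).1 = u.
  move/rootE => /(Fpre_fiber e2 good) [D0 Fw wu]; split=> //.
  by rewrite -[X in maps_to _ _ X]Fw; apply: maps_to_Fmap.
exists [:: Fpre w ((1 + s) / 2); Fpre w ((1 - s) / 2)]; split=> //.
  (* The two preimages have distinct [u]-coordinates, differing by [s]. *)
  rewrite /= inE andbT; apply: contra_neq s0 => e.
  have [_ h1] := preP _ (or_introl erefl); have [_ h2] := preP _ (or_intror erefl).
  move: h2; rewrite -e h1 => h; rewrite [LHS](_ : _ = (1 + s) / 2 - (1 - s) / 2); last by field.
  by rewrite h subrr.
move=> z; rewrite !inE; split.
  by case/orP => /eqP ->; [case: (preP _ (or_introl erefl)) | case: (preP _ (or_intror erefl))].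
move=> Fz; have [||D0 Fw] := maps_to_FmapE Fz.
- by apply: contra_neq w1 => zE; apply: hc1; rewrite -zE.
- by apply: contra_neq w2 => zE; apply: hc2; rewrite -zE.
have [u /rootE h ->] := Fmap_fiberP e2 good D0 Fw.
by case: h => ->; rewrite eqxx ?orbT.
Qed.

Lemma dominant_Fmap : dominant F.
Proof.
have [Q [Q0 h]] := topdeg_Fmap; apply: (dominant_generic Q0) => w /h [s [_ s2 hs]].
by case: s s2 hs => // z s _ /(_ z)[+ _]; rewrite mem_head => /(_ isT); exists z.
Qed.
End TopologicalDegree.

(** * Dynamical degree *)

Lemma rcomp_idl (K : fieldType) (g : ratmap K) : dominant g -> rcomp (ridm K) g = g.
Proof. by case: g => g1 g2 dg; rewrite /rcomp !(rsubst_domE dg) rsubst_xF rsubst_yF. Qed.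

Lemma dominant_snd_neq0 (K : fieldType) (g : ratmap K) : dominant g -> g.2 != 0.
Proof. by move=> dg; rewrite -psubstY dominant_neq0 // polyX_eq0. Qed.

(** One representation makes the set of degrees nonempty, so [xget] returns its minimum and not the
    default 0. *)
Lemma algdeg_min (K : fieldType) (H : ratmap K) d : deg_rep H d ->
  deg_rep H (algdeg H) /\ (algdeg H <= d)%N.
Proof.
move=> Hd; have ex : exists d, `[< deg_rep H d >] by exists d; apply/asboolP.
rewrite /algdeg; have : exists d, deg_rep H d /\ forall d', deg_rep H d' -> (d <= d')%N.
  case: (ex_minnP ex) => m /asboolP Hm minm; exists m; split=> // d' Hd'.
  by apply: minm; apply/asboolP.
by move/(xgetPex 0%N) => /= [h1 h2]; split=> //; apply: h2.
Qed.

(** Clears denominators in [winv]: for [u = P / M] and [v = A / B], [2 v - u] is [S / (B * M)] and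
    its square minus 9 is [Q / (B * M) ^+ 2]. *)
Lemma winv_div (E : fieldType) (P M A B : E) : 2 != 0 :> E -> M != 0 -> B != 0 ->
  let S := 2 * A * M - P * B in
  let Q := S ^+ 2 - 9 * (B * M) ^+ 2 in
  (2 * (A / B) - P / M) ^+ 2 - 9 != 0 ->
  Q != 0 /\ winv (P / M, A / B) = ((4 * (S + B * M) * A * M - Q) / Q, 8 * A * B * M ^+ 2 / Q).
Proof.
move=> e2 M0 B0 S Q d0.
have dE : (2 * (A / B) - P / M) ^+ 2 - 9 = Q / (B * M) ^+ 2.
  by rewrite /Q /S; field; rewrite M0 B0.
have Q0 : Q != 0 by apply: contra_neq d0 => Q0; rewrite dE Q0 mul0r.
split=> //; rewrite /winv [(_, _).1]/= [(_, _).2]/= dE.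
have sE : 2 * (A / B) - P / M = S / (B * M) by rewrite /S; field; rewrite M0 B0.
rewrite sE; move: Q0; clearbody S; move: Q {dE} => Q Q0.
by congr (_, _); field; rewrite ?e2 Q0 M0 B0.
Qed.

Lemma wmapKden_neq0 (E : fieldType) (z : E * E) : 2 != 0 :> E -> z.2 != 0 -> (wmap z).2 != 0 ->
  (2 * (wmap z).2 - (wmap z).1) ^+ 2 - 9 != 0.
Proof.
case: z => x y e2 y0 v0; rewrite (wmapKden e2) //.
by apply: mulf_neq0; [apply: mulf_neq0; [exact: eight_neq0 |] | rewrite invr_eq0].
Qed.

Lemma Gmap_div (E : fieldType) (P A B M : E) : P + 3 * M != 0 -> B != 0 -> M != 0 ->
  Gmap (P / M, A / B) = ((P ^+ 2 - P * M - 3 * M ^+ 2) / M ^+ 2,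
    (P - M) * (P + 2 * M) * A / ((P + 3 * M) * M * B)).
Proof. by move=> u0 B0 M0; rewrite /Gmap /=; congr (_, _); field; rewrite ?u0 ?B0 ?M0. Qed.

Lemma wmap1_div (E : fieldType) (A B C : E) : C != 0 -> B != 0 ->
  (wmap (A / C, B / C)).1 = (A ^+ 2 - C ^+ 2 - A * B - 2 * B ^+ 2) / (B * C).
Proof. by move=> C0 B0 /=; field; rewrite C0 B0. Qed.

Section DynamicalDegree.
Variable K : numClosedFieldType.
Local Notation x := (xF K).
Local Notation y := (yF K).
Local Notation F := (Fmap (x, y)).
Local Notation X := ('X%:P : {poly {poly K}}).
Local Notation Y := ('X : {poly {poly K}}).

Lemma wmap_add3_neq0 : (wmap (x, y)).1 + 3 != 0.
Proof.
rewrite wmap_add3 ?RF_y_neq0 //.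
apply: (@rval_neq0 _ (0, 2) _ ((0 - 1 + 2) * (0 + 1 - 2 * 2) / 2)).
  by rval_tac; exact: two_neq0.
rewrite (_ : (0 - 1 + 2) * (0 + 1 - 2 * 2) = - 3); last by ring.
by rewrite mulf_neq0 ?invr_eq0 ?oppr_eq0 ?pnatr_eq0.
Qed.

Lemma wmap_FmapRF : wmap F = Gmap (wmap (x, y)).
Proof.
have y0 := RF_y_neq0 K; have D0 := RF_Fden_neq0 K.
apply: (wmap_Fmap (RF_nat_neq0 K 1) y0 D0 _ wmap_add3_neq0).
exact: dominant_snd_neq0 (@dominant_Fmap K).
Qed.

Lemma rcomp_conj (W : ratmap K) : dominant W -> rcomp (wmap (x, y)) W = ridm K ->
  rcomp (wmap (x, y)) (rcomp F W) = Gmap (x, y).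
Proof.
move=> dW WK; have dF := @dominant_Fmap K; have dw := @dominant_wmap K.
rewrite -rcomp_assoc // (rcomp_wmap dF) wmap_FmapRF -(rcomp_Gmap dw) rcomp_assoc // WK.
exact: rcomp_idr.
Qed.

Lemma dominant_wmap_riter n : dominant (wmap (riter F n)).
Proof.
have dn := @dominant_iter K F n (@dominant_Fmap K).
by rewrite -(rcomp_wmap dn); exact: dominant_comp (@dominant_wmap K) dn.
Qed.

Lemma wmap_riterS n : wmap (riter F n.+1) = Gmap (wmap (riter F n)).
Proof.
have dF := @dominant_Fmap K.
have dn := dominant_iter (n := n) dF; have dn1 := dominant_iter (n := n.+1) dF.
have dw := @dominant_wmap K.
rewrite -(rcomp_wmap dn1) [riter F n.+1]/(rcomp F (riter F n)) -rcomp_assoc //.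
rewrite (rcomp_wmap dF) wmap_FmapRF -(rcomp_Gmap dw) rcomp_assoc //.
by rewrite rcomp_wmap // rcomp_Gmap //; exact: dominant_wmap_riter.
Qed.

Lemma riter_winv n : riter F n = winv (wmap (riter F n)).
Proof.
have dn := @dominant_iter K F n (@dominant_Fmap K); have dw := @dominant_wmap K.
rewrite -(rcomp_winv (dominant_wmap_riter (n := n))) -(rcomp_wmap dn) -rcomp_assoc //.
by rewrite rcomp_winv_wmap rcomp_idl.
Qed.

(** Numerator of the [n]-th iterate of [u ^+ 2 - u - 3] at [psi], over the denominator
    [Y ^+ (2 ^ n)]; [wmap_riterE] makes this precise. *)
Fixpoint unum n : {poly {poly K}} :=
  if n is n'.+1 then unum n' ^+ 2 - unum n' * 'X^(2 ^ n') - 3 * 'X^(2 ^ n') ^+ 2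
  else X ^+ 2 - 1 - X * Y - 2 * Y ^+ 2.

Fixpoint vnum n : {poly {poly K}} :=
  if n is n'.+1 then (unum n' - 'X^(2 ^ n')) * (unum n' + 2 * 'X^(2 ^ n')) * vnum n'
  else (1 + X - 2 * Y) * (1 + X + Y).

Fixpoint vden n : {poly {poly K}} :=
  if n is n'.+1 then (unum n' + 3 * 'X^(2 ^ n')) * 'X^(2 ^ n') * vden n' else 2 * Y.

Lemma coef0_mulXn (p : {poly {poly K}}) n : (p * 'X^(2 ^ n))`_0 = 0.
Proof. by rewrite coefMXn expn_gt0. Qed.

(** On [y = 0] the recursion reduces to squaring, starting from [x ^+ 2 - 1]. Hence the pole of
    order [2 ^ n] along [y = 0] does not cancel. *)
Lemma unum_coef0 n : (unum n)`_0 != 0.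
Proof.
elim: n => [|n IHn] /=.
  rewrite -horner_coef0 !hornerE /= !mulr0 !subr0 -polyC1.
  by rewrite -size_poly_eq0 size_XnsubC.
rewrite -horner_coef0 !hornerE expr0n expn_eq0 /= !mulr0 !subr0.
by rewrite -horner_coef0 in IHn; rewrite mulf_neq0.
Qed.

Lemma vden_neq0 n : vden n != 0.
Proof.
elim: n => [|n IHn] /=.
  by rewrite mulf_neq0 ?polyX_eq0 // -polyC_natr polyC_eq0 -polyC_natr polyC_eq0 two_neq0.
apply: mulf_neq0 => //; apply: mulf_neq0; last by rewrite expf_neq0 ?polyX_eq0.
apply: contra_neq (unum_coef0 n) => /(congr1 (fun p : {poly {poly K}} => p`_0)).
by rewrite coefD coef0_mulXn addr0 coef0.
Qed.

Lemma wmap_riterE n : wmap (riter F n) =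
  (tofrac (unum n) / tofrac 'X^(2 ^ n), tofrac (vnum n) / tofrac (vden n)).
Proof.
elim: n => [|n IHn].
  rewrite /wmap /= expn0 expr1 -[tofrac 'X]/y.
  by rewrite !(rmorph_nat, rmorphXn, rmorphD, rmorphM, rmorphN, rmorph1) /=.
rewrite wmap_riterS IHn.
have u0 : tofrac (unum n + 3 * 'X^(2 ^ n)) != 0.
  by have := vden_neq0 n.+1; rewrite /= !mulf_eq0 !negb_or tofrac_eq0 => /andP[/andP[]].
have v0 : tofrac (vden n) != 0 by rewrite tofrac_eq0 vden_neq0.
have M0 : tofrac ('X^(2 ^ n) : {poly {poly K}}) != 0 by rewrite tofrac_eq0 expf_neq0 ?polyX_eq0.
rewrite [unum n.+1]/= [vnum n.+1]/= [vden n.+1]/= expnSr exprM.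
move: u0 v0 M0; rewrite !(rmorph_nat, rmorphXn, rmorphD, rmorphM, rmorphN, rmorph1) /=.
move: (tofrac (unum n)) (tofrac (vnum n)) (tofrac (vden n)) (tofrac 'X ^+ _) => P A B M.
exact: Gmap_div.
Qed.

Lemma tdeg_Ypow n : (tdeg ('X^(2 ^ n) : {poly {poly K}}) <= 2 ^ n)%N.
Proof. by have := tdegXn_le (2 ^ n) (tdegY K); rewrite muln1. Qed.

Lemma tdeg_natM (p : {poly {poly K}}) k d : (tdeg p <= d)%N -> (tdeg (k%:R * p) <= d)%N.
Proof. by move=> pd; apply: leq_trans (tdegM_le (leqnn _) pd) _; rewrite tdeg_nat. Qed.

Lemma tdeg_unum n : (tdeg (unum n) <= 2 * 2 ^ n)%N.
Proof.
have h := tdeg_Ypow; elim: n => [|n IHn] /=.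
  by rewrite !tdegB_le ?(tdegXn_le 2 (tdegX K)) ?(tdegM_le (tdegX K) (tdegY K))
    ?tdeg_natM ?(tdegXn_le 2 (tdegY K)) // (tdeg_nat K 1).
rewrite !tdegB_le //.
- by apply: leq_trans (tdegXn_le 2 IHn) _; rewrite expnS; lia.
- by apply: leq_trans (tdegM_le IHn (h n)) _; rewrite expnS; lia.
- by apply: tdeg_natM; apply: leq_trans (tdegXn_le 2 (h n)) _; rewrite expnS; lia.
Qed.

(** Each step multiplies by two factors of degree at most [2 * 2 ^ n], which doubles the bound
    [4 * 2 ^ n]. *)
Lemma tdeg_vnum n : (tdeg (vnum n) <= 4 * 2 ^ n)%N.
Proof.
elim: n => [|n IHn] /=.
  have t1 := tdegX K; have t2 := tdegY K.
  have t0 : (tdeg (1 : {poly {poly K}}) <= 1)%N by rewrite (tdeg_nat K 1).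
  apply: (@leq_trans (1 + 1)) => //.
  apply: tdegM_le.
    exact: tdegB_le (tdegD_le t0 t1) (tdeg_natM _ t2).
  exact: tdegD_le (tdegD_le t0 t1) t2.
have hu := tdeg_unum n; have hM := tdeg_Ypow n.
have hM' : (tdeg ('X^(2 ^ n) : {poly {poly K}}) <= 2 * 2 ^ n)%N by lia.
apply: leq_trans (tdegM_le (tdegM_le (tdegB_le hu hM') (tdegD_le hu (tdeg_natM _ hM'))) IHn) _.
by rewrite expnS; lia.
Qed.

Lemma tdeg_vden n : (tdeg (vden n) <= 4 * 2 ^ n)%N.
Proof.
elim: n => [|n IHn] /=.
  by apply: leq_trans (tdeg_natM _ (tdegY K)) _.
have hu := tdeg_unum n; have hM := tdeg_Ypow n.
have hM' : (tdeg ('X^(2 ^ n) : {poly {poly K}}) <= 2 * 2 ^ n)%N by lia.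
apply: leq_trans (tdegM_le (tdegM_le (tdegD_le hu (tdeg_natM _ hM')) hM) IHn) _.
by rewrite expnS; lia.
Qed.

Lemma deg_rep_riter_ub n : exists2 d, deg_rep (riter F n) d & (d <= 12 * 2 ^ n)%N.
Proof.
pose P := unum n; pose M : {poly {poly K}} := 'X^(2 ^ n); pose A := vnum n; pose B := vden n.
have M0 : tofrac M != 0 by rewrite tofrac_eq0 expf_neq0 ?polyX_eq0.
have B0 : tofrac B != 0 by rewrite tofrac_eq0 vden_neq0.
pose S := 2 * A * M - P * B; pose Q := S ^+ 2 - 9 * (B * M) ^+ 2.
have dn := @dominant_iter K F n (@dominant_Fmap K).
have y0 := dominant_snd_neq0 dn.
have v0 := dominant_snd_neq0 (dominant_wmap_riter (n := n)).
have e2 := RF_nat_neq0 K 1.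
have d0 := wmapKden_neq0 e2 y0 v0.
rewrite wmap_riterE in d0; have [Q0 WE] := winv_div e2 M0 B0 d0.
have QE : (2 * tofrac A * tofrac M - tofrac P * tofrac B) ^+ 2 -
   9 * (tofrac B * tofrac M) ^+ 2 = tofrac Q.
  by rewrite /Q /S !(tofracXn, tofracB, tofracM, rmorph_nat).
rewrite QE in Q0 WE; rewrite tofrac_eq0 in Q0.
exists (maxn (tdeg (4 * (S + B * M) * A * M - Q)) (maxn (tdeg (8 * A * B * M ^+ 2)) (tdeg Q))).
  exists (4 * (S + B * M) * A * M - Q), (8 * A * B * M ^+ 2), Q; split=> //.
  - rewrite riter_winv wmap_riterE WE; congr (_ / _).
    by rewrite /S !(tofracXn, tofracB, tofracD, tofracM, rmorph_nat).
  - rewrite riter_winv wmap_riterE WE; congr (_ / _).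
    by rewrite !(tofracXn, tofracB, tofracD, tofracM, rmorph_nat).
have [hP hA hB hM] := And4 (tdeg_unum n) (tdeg_vnum n) (tdeg_vden n) (tdeg_Ypow n).
(* The constant 12 is twice this 6, because [Q] is quadratic in [S] and [B * M]. *)
have hS : (tdeg S <= 6 * 2 ^ n)%N.
  apply: tdegB_le.
    by apply: leq_trans (tdegM_le (tdeg_natM _ hA) hM) _; lia.
  by apply: leq_trans (tdegM_le hP hB) _; lia.
have hBM : (tdeg (B * M) <= 6 * 2 ^ n)%N by apply: leq_trans (tdegM_le hB hM) _; lia.
have hQ : (tdeg Q <= 12 * 2 ^ n)%N.
  apply: tdegB_le; first by apply: leq_trans (tdegXn_le 2 hS) _; lia.
  by apply: leq_trans (tdeg_natM _ (tdegXn_le 2 hBM)) _; lia.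
rewrite !geq_max hQ andbT; apply/andP; split.
  apply: tdegB_le hQ.
  by apply: leq_trans (tdegM_le (tdegM_le (tdeg_natM _ (tdegD_le hS hBM)) hA) hM) _; lia.
by apply: leq_trans (tdegM_le (tdegM_le (tdeg_natM _ hA) hB) (tdegXn_le 2 hM)) _; lia.
Qed.

(** Writing the iterate as [(A / C, B / C)] gives its [u]-coordinate the denominator [B * C], of
    degree at most [2 * d]. As [Y] does not divide [unum n], the power [Y ^+ (2 ^ n)] must divide
    [B * C]. *)
Lemma deg_rep_riter_lb n d : deg_rep (riter F n) d -> (2 ^ n <= 2 * d)%N.
Proof.
move=> [A [B [C [C0 H1 H2 dE]]]].
have [hA hB hC] : [/\ tdeg A <= d, tdeg B <= d & tdeg C <= d]%N.
  by rewrite -dE !leq_max !leqnn !orbT.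
have B0 : B != 0.
  have := dominant_snd_neq0 (@dominant_iter K F n (@dominant_Fmap K)).
  by rewrite H2; apply: contra_neq => ->; rewrite tofrac0 mul0r.
have M0 : tofrac ('X^(2 ^ n) : {poly {poly K}}) != 0 by rewrite tofrac_eq0 expf_neq0 ?polyX_eq0.
have e : (wmap (tofrac A / tofrac C, tofrac B / tofrac C)).1 = tofrac (unum n) / tofrac 'X^(2 ^ n).
  by rewrite -H1 -H2 -surjective_pairing wmap_riterE.
have tB0 : tofrac B != 0 by rewrite tofrac_eq0.
have tC0 : tofrac C != 0 by rewrite tofrac_eq0.
rewrite (wmap1_div _ tC0 tB0) in e.
have NE : tofrac (A ^+ 2 - C ^+ 2 - A * B - 2 * B ^+ 2) =
    tofrac A ^+ 2 - tofrac C ^+ 2 - tofrac A * tofrac B - 2 * tofrac B ^+ 2.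
  by rewrite !(tofracXn, tofracB, tofracM, rmorph_nat).
have BC0 : B * C != 0 by apply: mulf_neq0.
have tBC0 : tofrac (B * C) != 0 by rewrite tofrac_eq0.
rewrite -NE -tofracM in e.
move/eqP: e; rewrite (eqr_div _ _ tBC0 M0).
rewrite -!tofracM tofrac_eq.
rewrite [X in _ == X]mulrC => /eqP/dvdXn_coef0_neq0/(_ (unum_coef0 n))[N' BC].
apply: (@leq_trans (tdeg (B * C))); last by apply: leq_trans (tdegM_le hB hC) _; lia.
rewrite BC leq_tdeg_mulXn //; apply: contra_neq BC0 => N0; by rewrite BC N0 mul0r.
Qed.
End DynamicalDegree.

(** * The conjugacy and both degrees together *)

Lemma Fmap_conjugacy_degrees (K : numClosedFieldType) :
  let x := xF K in let y := yF K in
  let F : ratmap K :=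
    (x + 2 * y ^+ 2 * (- x ^+ 2 + x + y ^+ 2) /
           ((x - 1 - y) * (x ^+ 2 - 1 + y - y ^+ 2)),
     y ^+ 2 * (x - 1 + y) / ((x - 1 - y) * (x ^+ 2 - 1 + y - y ^+ 2))) in
  let varpi : ratmap K :=
    ((x ^+ 2 - 1 - x * y - 2 * y ^+ 2) / y,
     (1 + x - 2 * y) * (1 + x + y) / (2 * y)) in
  let G : ratmap K :=
    (x ^+ 2 - x - 3, (x - 1) * (x + 2) / (x + 3) * y) in
  let psi := (x ^+ 2 - 1 - x * y - 2 * y ^+ 2) / y in
  [/\ exists varpi_inv : ratmap K,
        rcomp varpi varpi_inv = ridm K /\ rcomp varpi_inv varpi = ridm K,
      forall varpi_inv : ratmap K,
        rcomp varpi varpi_inv = ridm K -> rcomp varpi_inv varpi = ridm K ->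
        rcomp varpi (rcomp F varpi_inv) = G,
      rsubst psi F = psi ^+ 2 - psi - 3,
      topdeg_is F 2
    & forall n, (2 ^ n <= 2 * algdeg (riter F n) <= 24 * 2 ^ n)%N].
Proof.
move=> x y F varpi G psi.
have dw : dominant (wmap (x, y)) by exact: dominant_wmap.
have dF : dominant (Fmap (x, y)) by exact: dominant_Fmap.
split.
- exists (winv (x, y)).
  split; [exact: rcomp_wmap_winv | exact: rcomp_winv_wmap].
- move=> W WK KW; apply: rcomp_conj WK; exact: dominant_rinv dw KW.
- have /(congr1 fst) := rcomp_wmap dF; rewrite wmap_FmapRF /rcomp /Gmap.
  by rewrite ![(_, _).1]/=.
- exact: topdeg_Fmap.
move=> n; have [d hd dle] := deg_rep_riter_ub K n.
have [/deg_rep_riter_lb h1 h2] := algdeg_min hd.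
by rewrite h1 (leq_trans (leq_mul (leqnn 2) (leq_trans h2 dle))) // mulnA.
Qed.

Theorem theorem7p1 (R : realType) :
  let x := xF R[i] in let y := yF R[i] in
  let F : ratmap R[i] :=
    (x + 2 * y ^+ 2 * (- x ^+ 2 + x + y ^+ 2) /
           ((x - 1 - y) * (x ^+ 2 - 1 + y - y ^+ 2)),
     y ^+ 2 * (x - 1 + y) / ((x - 1 - y) * (x ^+ 2 - 1 + y - y ^+ 2))) in
  let varpi : ratmap R[i] :=
    ((x ^+ 2 - 1 - x * y - 2 * y ^+ 2) / y,
     (1 + x - 2 * y) * (1 + x + y) / (2 * y)) in
  let G : ratmap R[i] :=
    (x ^+ 2 - x - 3, (x - 1) * (x + 2) / (x + 3) * y) in
  let psi := (x ^+ 2 - 1 - x * y - 2 * y ^+ 2) / y in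
  [/\ exists varpi_inv : ratmap R[i],
        rcomp varpi varpi_inv = ridm R[i] /\ rcomp varpi_inv varpi = ridm R[i],
      forall varpi_inv : ratmap R[i],
        rcomp varpi varpi_inv = ridm R[i] -> rcomp varpi_inv varpi = ridm R[i] ->
        rcomp varpi (rcomp F varpi_inv) = G,
      rsubst psi F = psi ^+ 2 - psi - 3,
      topdeg_is F 2
    & dyn_deg_is F 2].
Proof.
Proof.
have [h1 h2 h3 h4 h5] := Fmap_conjugacy_degrees R[i].
move=> x y F varpi G psi; split=> //.
(* The bounds are [2 ^ n / 2] and [12 * 2 ^ n]; since [1 / 12 <= 1 / 2], the single constant 12
   serves on both sides. *)
apply: (@cvg_root_sandwich R _ 12); rewrite ?ltr0n // => n.
have /andP[lb ub] := h5 n; rewrite ler_pdivrMl ?ltr0n // -natrX -!natrM !ler_nat.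
rewrite (leq_trans lb) ?leq_mul2r ?orbT //=.
by rewrite -(leq_pmul2l (isT : 0 < 2)%N) mulnA.
Qed.
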